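(* Let $M=(E,r)$ be an arbitrary matroid on a finite set $E$ with rank function $r$. Then, as identities of rational functions in the variable $q$, $$\chi_{M^\perp}(q)=(q-1)^{|E|}\sum_{A\subseteq E}\Big(\frac{q}{1-q}\Big)^{|A|}\frac{\chi_{M|_A}(q)}{q^{r(A)}},$$ $$\chi_{M^\perp}(q)=q^{-r(E)}\sum_{A\subseteq E}(-1)^{|E|-|A|}(q-1)^{|A|}\chi_{M/A}(q).$$
   Context: For a matroid $N$ on ground set $S$ with rank function $r_N$, the characteristic polynomial is $\chi_N(x)=\sum_{X\subseteq S}(-1)^{|X|}x^{r_N(S)-r_N(X)}$. $M^\perp$ is the dual matroid on $E$ with rank function $r^\perp(A)=|A|-r(E)+r(E\setminus A)$. $M|_A$ is the restriction of $M$ to $A$ (ground set $A$, rank function $r$ restricted to subsets of $A$), and $M/A$ is the contraction of $A$ (ground set $E\setminus A$, rank function $X\mapsto r(X\cup A)-r(A)$). *)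

(* Defs.v *)
From mathcomp Require Import all_boot all_order all_algebra.
From mathcomp Require Import zify.

Set Implicit Arguments.
Unset Strict Implicit.
Unset Printing Implicit Defensive.

Import GRing.Theory.

(* The ground set is a finite subset of an ambient finite type, so that a      *)
(* matroid and its minors live in the same type.  The values of the rank       *)
(* function on sets not contained in the ground set are irrelevant.            *)
Record matroid (T : finType) := Matroid {
  ground : {set T};
  rk : {set T} -> nat;
  rk_le_card : forall X : {set T}, X \subset ground -> rk X <= #|X|;
  rk_mono : forall X Y : {set T}, X \subset Y -> Y \subset ground ->
    rk X <= rk Y;
  rk_submod : forall X Y : {set T}, X \subset ground -> Y \subset ground ->
    rk (X :|: Y) + rk (X :&: Y) <= rk X + rk Y
}.

Section Constructions.
Variables (T : finType) (M : matroid T).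
Local Notation E := (ground M).
Local Notation r := (rk M).

(* |A| - r(E) + r(E \ A), reordered so that the subtraction does not truncate  *)
(* (dual_rk_spec).                                                             *)
Definition dual_rk (A : {set T}) : nat := #|A| + r (E :\: A) - r E.

Lemma rk_diff (A B : {set T}) : A \subset B -> B \subset E ->
  r (E :\: A) <= r (E :\: B) + #|B :\: A|.
Proof.
move=> sAB sBE; have sBAE : B :\: A \subset E by
  apply: subset_trans sBE; apply: subsetDl.
have -> : E :\: A = (E :\: B) :|: (B :\: A).
  apply/setP=> x; rewrite !inE.
  have := subsetP sAB x; have := subsetP sBE x.
  by case: (x \in A); case: (x \in B); case: (x \in E) => //= H1 H2;
    (have := H1 isT) || (have := H2 isT).
have := rk_submod (subsetDl E B) sBAE; have := rk_le_card sBAE; lia.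
Qed.

Lemma dual_rk_spec (A : {set T}) : A \subset E ->
  dual_rk A + r E = #|A| + r (E :\: A).
Proof.
by move=> sAE; have := rk_diff (sub0set A) sAE; rewrite !setD0 /dual_rk; lia.
Qed.

Lemma dual_rk_le_card (A : {set T}) : A \subset E -> dual_rk A <= #|A|.
Proof.
by move=> _; have := rk_mono (subsetDl E A) (subxx E); rewrite /dual_rk; lia.
Qed.

Lemma dual_rk_mono (A B : {set T}) : A \subset B -> B \subset E ->
  dual_rk A <= dual_rk B.
Proof.
move=> sAB sBE; have := rk_diff sAB sBE.
by have := cardsID A B; rewrite (setIidPr sAB) /dual_rk; lia.
Qed.

Lemma dual_rk_submod (A B : {set T}) : A \subset E -> B \subset E ->
  dual_rk (A :|: B) + dual_rk (A :&: B) <= dual_rk A + dual_rk B.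
Proof.
move=> sA sB; have sU : A :|: B \subset E by rewrite subUset sA.
have sI : A :&: B \subset E by apply: subset_trans sA; apply: subsetIl.
have := dual_rk_spec sA; have := dual_rk_spec sB.
have := dual_rk_spec sU; have := dual_rk_spec sI; rewrite setDUr setDIr.
have := rk_submod (subsetDl E A) (subsetDl E B); have := cardsUI A B; lia.
Qed.

Definition dual : matroid T :=
  Matroid dual_rk_le_card dual_rk_mono dual_rk_submod.

Section Minors.
Variable A : {set T}.

(* Minors are made total in A by intersecting with the ground set; for         *)
(* A \subset E one has E :&: A = A.                                            *)
Lemma restrict_le_card (X : {set T}) : X \subset E :&: A -> r X <= #|X|.
Proof. by rewrite subsetI => /andP[sX _]; apply: rk_le_card. Qed.

Lemma restrict_mono (X Y : {set T}) : X \subset Y -> Y \subset E :&: A ->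
  r X <= r Y.
Proof. by move=> sXY; rewrite subsetI => /andP[sY _]; apply: rk_mono. Qed.

Lemma restrict_submod (X Y : {set T}) :
    X \subset E :&: A -> Y \subset E :&: A ->
  r (X :|: Y) + r (X :&: Y) <= r X + r Y.
Proof.
by rewrite !subsetI => /andP[sX _] /andP[sY _]; apply: rk_submod.
Qed.

Definition restriction : matroid T :=
  Matroid restrict_le_card restrict_mono restrict_submod.

Definition contract_rk (X : {set T}) : nat :=
  r (X :|: (E :&: A)) - r (E :&: A).

Lemma contract_sub (X : {set T}) : X \subset E :\: A ->
  X :|: (E :&: A) \subset E.
Proof.
by move=> sX; rewrite subUset subsetIl (subset_trans sX (subsetDl _ _)).
Qed.

Lemma contract_le_card (X : {set T}) : X \subset E :\: A ->
  contract_rk X <= #|X|.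
Proof.
move=> sX; have sXE := subset_trans sX (subsetDl _ _).
have := rk_submod sXE (subsetIl E A); have := rk_le_card sXE.
rewrite /contract_rk; lia.
Qed.

Lemma contract_mono (X Y : {set T}) : X \subset Y -> Y \subset E :\: A ->
  contract_rk X <= contract_rk Y.
Proof.
move=> sXY sY; apply: leq_sub2r.
exact: rk_mono (setSU _ sXY) (contract_sub sY).
Qed.

Lemma contract_submod (X Y : {set T}) :
    X \subset E :\: A -> Y \subset E :\: A ->
  contract_rk (X :|: Y) + contract_rk (X :&: Y) <=
  contract_rk X + contract_rk Y.
Proof.
move=> sX sY; have cX := contract_sub sX; have cY := contract_sub sY.
have := rk_submod cX cY; rewrite -setUUl -setUIl.
have := rk_mono (subsetUr X _) cX; have := rk_mono (subsetUr Y _) cY.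
have sI : X :&: Y \subset E :\: A by apply: subset_trans sX; apply: subsetIl.
have sU : X :|: Y \subset E :\: A by rewrite subUset sX.
have := rk_mono (subsetUr (X :&: Y) _) (contract_sub sI).
have := rk_mono (subsetUr (X :|: Y) _) (contract_sub sU).
rewrite /contract_rk; lia.
Qed.

Definition contraction : matroid T :=
  Matroid contract_le_card contract_mono contract_submod.

End Minors.
End Constructions.

Local Open Scope ring_scope.

Definition chi (T : finType) (N : matroid T) : {poly int} :=
  \sum_(X : {set T} | X \subset ground N)
    (-1) ^+ #|X| * 'X ^+ (rk N (ground N) - rk N X)%N.

(* Frac(Z[q]) = Q(q), the field of rational functions in q. *)
Definition q : {fraction {poly int}} := tofrac 'X.

Definition chiq (T : finType) (N : matroid T) : {fraction {poly int}} :=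
  tofrac (chi N).

(* Main.v *)
Require Import Defs.
From mathcomp Require Import all_boot all_order all_algebra.
From mathcomp Require Import zify ring.

(** Complementing the summation index in the definition of the dual rank gives
    [chi_{M^perp}(q) = \sum_(Y \subset E) (-1)^(|E|-|Y|) q^(|Y| - r(Y))].  In
    both right-hand sides, exchanging the two sums leaves an inner binomial sum
    over an interval of subsets: over [X \subset A \subset E] with weight
    [q/(1-q)], resp. over [A \subset Y] where [Y] is the union of [A] with the
    summation set of [chi_{M/A}]. *)

Import GRing.Theory.
Local Open Scope ring_scope.

(** Binomial theorem on a Boolean interval: each point of [Y :\: X] freely contributes [t] (inside
    [A]) or [u] (outside [A]). *)
Lemma sum_subset_interval (R : comNzRingType) (T : finType) (X Y : {set T})
    (t u : R) : X \subset Y ->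
  \sum_(A : {set T} | (X \subset A) && (A \subset Y))
     t ^+ #|A :\: X| * u ^+ #|Y :\: A| = (t + u) ^+ #|Y :\: X|.
Proof.
move=> sXY.
(* [F i] is the weight of [i] when it lies in [A], [G i] when it does not. The zeros discard every
   [A] outside the interval, and the ones make the remaining points neutral. *)
pose F i := if i \in X then 1 else if i \in Y then t else 0.
pose G i := if i \in X then 0 else if i \in Y then u else 1.
have -> : (t + u) ^+ #|Y :\: X| = \prod_(i : T) (F i + G i).
  rewrite -prodr_const big_mkcond /=; apply: eq_bigr => i _; rewrite !inE /F /G.
  by case: (i \in X); case: (i \in Y); rewrite /= ?addr0 ?add0r.
rewrite bigA_distr big_mkcond /=; apply: eq_bigr => A _.
case: ifPn => [/andP[/subsetP sXA /subsetP sAY]|].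
  rewrite -!prodr_const (big_mkcond (mem (A :\: X))).
  rewrite (big_mkcond (mem (Y :\: A))).
  rewrite -big_split /=; apply: eq_bigr => i _; rewrite !inE /F /G.
  have := sXA i; have := sAY i.
  case: (i \in A) => [/(_ isT) ->|_].
    by case: (i \in X); rewrite /= ?mulr1.
  case: (i \in X) => [/(_ isT)//|_].
  by case: (i \in Y); rewrite /= ?mul1r.
(* A point of [X :\: A] gives a factor [G i = 0], a point of [A :\: Y] a factor [F i = 0]. *)
rewrite negb_and => /orP[] /subsetPn[i i1 i2]; rewrite (bigD1 i) //=.
  by rewrite (negbTE i2) /G i1 mul0r.
have /negbTE iX : i \notin X by apply: contra i2; apply: (subsetP sXY).
by rewrite i1 /F iX (negbTE i2) mul0r.
Qed.

Lemma cardsD_sub (T : finType) (A B : {set T}) :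
  A \subset B -> (#|A| + #|B :\: A| = #|B|)%N.
Proof. by move=> sAB; rewrite -(cardsID A B) (setIidPr sAB). Qed.

Section CharacteristicSums.

Variables (F : fieldType) (x : F) (T : finType).
Hypothesis x_neq0 : x != 0.

(** Evaluation at an element of an arbitrary field, so that the computations do not depend on how
    the rational functions are built. *)
Definition chi_at (N : matroid T) : F :=
  \sum_(X : {set T} | X \subset ground N)
    (-1) ^+ #|X| * x ^+ (rk N (ground N) - rk N X)%N.

Lemma chi_at_dual (M : matroid T) :
  chi_at (dual M) = (-1) ^+ #|ground M| *
    \sum_(Y : {set T} | Y \subset ground M) (- x) ^+ #|Y| / x ^+ rk M Y.
Proof.
set E := ground M; rewrite /chi_at /= -/E mulr_sumr.
rewrite [LHS](reindex_onto (fun Y => E :\: Y) (fun Y => E :\: Y)) /=; last first.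
  by move=> X sX; rewrite setDDr setDv set0U; apply/setIidPr.
apply: eq_big => [Y|Y /andP[_ /eqP defY]].
  rewrite subsetDl /= setDDr setDv set0U.
  by apply/eqP/idP => [<-|/setIidPr //]; apply: subsetIl.
have sYE : Y \subset E by rewrite -defY subsetDl.
have cE := cardsD_sub _ _ _ sYE.
have dE := dual_rk_spec (subxx E).
have := dual_rk_spec (subsetDl E Y); rewrite defY => dY.
have rY := rk_le_card sYE.
have r0 : rk M set0 = 0%N.
  by apply/eqP; rewrite -leqn0 -(cards0 T) rk_le_card ?sub0set.
rewrite setDv r0 in dE.
(* The two dual ranks are [|E| - r(E)] and [|E| - |Y| - r(E) + r(Y)]. *)
have -> : (dual_rk M E - dual_rk M (E :\: Y) = #|Y| - rk M Y)%N by lia.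
rewrite expfB_cond ?(negbTE x_neq0) // -cE exprD [(- x) ^+ _]exprNn.
by rewrite -!mulrA (mulrCA ((-1) ^+ #|E :\: Y|) ((-1) ^+ #|Y|)) signrMK.
Qed.

(** Division by [x ^+ rk M A] makes each summand independent of [A], ready for the exchange of
    sums. *)
Lemma chi_at_restriction (M : matroid T) (A : {set T}) :
    A \subset ground M ->
  chi_at (restriction M A) / x ^+ rk M A =
    \sum_(X : {set T} | X \subset A) (-1) ^+ #|X| / x ^+ rk M X.
Proof.
move=> sA; rewrite /chi_at /= (setIidPr sA) mulr_suml; apply: eq_bigr => X sX.
rewrite expfB_cond ?(negbTE x_neq0) ?rk_mono //.
by field; rewrite !expf_neq0.
Qed.

(** With [Y] the union of [X] and [A], the two subtractions of [r(A)] cancel, and [A] survives only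
    in the sign and the range. *)
Lemma chi_at_contraction (M : matroid T) (A : {set T}) :
    A \subset ground M ->
  chi_at (contraction M A) =
    \sum_(Y : {set T} | (A \subset Y) && (Y \subset ground M))
      (-1) ^+ #|Y :\: A| * (x ^+ rk M (ground M) / x ^+ rk M Y).
Proof.
move=> sA; set E := ground M; rewrite /chi_at /= -/E.
rewrite (reindex_onto (fun Y => Y :\: A) (fun X => X :|: A)) /=; last first.
  move=> X; rewrite subsetD => /andP[_ dXA].
  by rewrite setDUl setDv setU0; apply/setDidPl.
have DU (Y : {set T}) : Y :\: A :|: A = Y :|: A.
  by apply/setP=> i; rewrite !inE; case: (i \in A); rewrite ?orbT ?orbF.
apply: eq_big => [Y|Y /andP[sYE]].
  rewrite DU andbC; have -> : (Y :|: A == Y) = (A \subset Y).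
    by apply/eqP/idP => [<-|/setUidPl //]; rewrite subsetUr.
  case sAY: (A \subset Y) => //=.
  apply/idP/idP => [sYE|]; last exact: setSD.
  by rewrite -(setUidPl sAY) -DU subUset sA (subset_trans sYE (subsetDl _ _)).
rewrite DU => /eqP/setUidPl sAY.
have sY : Y \subset E.
  by rewrite -(setUidPl sAY) -DU subUset sA (subset_trans sYE (subsetDl _ _)).
rewrite /contract_rk -/E (setIidPr sA) !DU (setUidPl sAY) (setUidPl sA).
have rAY := rk_mono sAY sY; have rYE := rk_mono sY (subxx _).
have -> : (rk M E - rk M A - (rk M Y - rk M A) = rk M E - rk M Y)%N.
  by rewrite -/E in rYE; lia.
by rewrite expfB_cond ?(negbTE x_neq0).
Qed.

Lemma chi_at_dual_restriction (M : matroid T) : 1 - x != 0 ->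
  chi_at (dual M) =
    (x - 1) ^+ #|ground M| *
    \sum_(A : {set T} | A \subset ground M)
      (x / (1 - x)) ^+ #|A| * (chi_at (restriction M A) / x ^+ rk M A).
Proof.
move=> x_neq1; rewrite chi_at_dual.
under [in RHS]eq_bigr => A sA do rewrite chi_at_restriction // mulr_sumr.
rewrite (exchange_big_dep (fun X : {set T} => X \subset ground M)) /=; last first.
  by move=> A X sA /subset_trans; apply.
rewrite !mulr_sumr; apply: eq_bigr => X sX.
rewrite -mulr_suml.
have -> : \sum_(A : {set T} | (A \subset ground M) && (X \subset A))
      (x / (1 - x)) ^+ #|A|
    = (x / (1 - x)) ^+ #|X| * (1 - x)^-1 ^+ #|ground M :\: X|.
  (* The binomial sum is used with [t = x / (1 - x)] and [u = 1]. *)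
  have t1 : (1 - x)^-1 = x / (1 - x) + 1 by field.
  rewrite [in (1 - x)^-1 ^+ _]t1 -sum_subset_interval // mulr_sumr.
  apply: eq_big => [A|A /andP[_ sXA]]; first by rewrite andbC.
  by rewrite expr1n mulr1 -exprD cardsD_sub.
(* Splitting [|E|] as [|X| + |E :\: X|] lets all powers of [1 - x] cancel. *)
rewrite -(cardsD_sub _ _ _ sX) !exprD -[x - 1]opprB !(exprNn (1 - x)).
rewrite (exprNn x) expr_div_n exprVn.
by field; rewrite !expf_neq0.
Qed.

Lemma chi_at_dual_contraction (M : matroid T) :
  chi_at (dual M) =
    x ^- rk M (ground M) *
    \sum_(A : {set T} | A \subset ground M)
      (-1) ^+ (#|ground M| - #|A|) * (x - 1) ^+ #|A| * chi_at (contraction M A).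
Proof.
rewrite chi_at_dual.
under [in RHS]eq_bigr => A sA do rewrite chi_at_contraction // mulr_sumr.
rewrite (exchange_big_dep (fun Y : {set T} => Y \subset ground M)) /=; last first.
  by move=> A Y _ /andP[].
rewrite !mulr_sumr; apply: eq_bigr => Y sY.
have -> : (- x) ^+ #|Y| = \sum_(A : {set T} | A \subset Y)
    (1 - x) ^+ #|A| * (-1) ^+ #|Y :\: A|.
  (* Here the interval runs from the empty set to [Y], with [t = 1 - x] and [u = -1]. *)
  have t1 : - x = (1 - x) + -1 by ring.
  rewrite -{1}[Y]setD0 [in (- x) ^+ _]t1 -sum_subset_interval ?sub0set //.
  by apply: eq_big => [A|A _]; rewrite ?sub0set ?setD0.
rewrite mulr_suml !mulr_sumr; apply: eq_big => [A|A sAY].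
  rewrite sY andbT; case sAY: (A \subset Y); rewrite ?andbF //.
  by rewrite (subset_trans sAY sY).
have sA := subset_trans sAY sY.
rewrite -(cardsD_sub _ _ _ sA) addKn !exprD -[x - 1]opprB (exprNn (1 - x)).
by field; rewrite !expf_neq0.
Qed.

End CharacteristicSums.

Lemma q_neq0 : q != 0.
Proof. by rewrite tofrac_eq0 polyX_eq0. Qed.

Lemma one_sub_q_neq0 : 1 - q != 0.
Proof.
by rewrite -oppr_eq0 opprB /q -tofrac1 -tofracB tofrac_eq0 polyXsubC_eq0.
Qed.

Lemma chiqE (T : finType) (N : matroid T) : chiq N = chi_at _ q _ N.
Proof.
rewrite /chiq /chi rmorph_sum /=; apply: eq_bigr => X _.
by rewrite rmorphM !rmorphXn rmorphN rmorph1.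
Qed.

Theorem theorem2 (T : finType) (M : matroid T) :
  chiq (dual M) =
    (q - 1) ^+ #|ground M| *
    \sum_(A : {set T} | A \subset ground M)
      (q / (1 - q)) ^+ #|A| * (chiq (restriction M A) / q ^+ rk M A)
  /\
  chiq (dual M) =
    q ^- rk M (ground M) *
    \sum_(A : {set T} | A \subset ground M)
      (-1) ^+ (#|ground M| - #|A|) * (q - 1) ^+ #|A| * chiq (contraction M A).
Proof.
split; rewrite chiqE.
  rewrite (chi_at_dual_restriction _ _ _ q_neq0 _ one_sub_q_neq0).
  by under [in RHS]eq_bigr => A _ do rewrite chiqE.
rewrite (chi_at_dual_contraction _ _ _ q_neq0).
by under [in RHS]eq_bigr => A _ do rewrite chiqE.
Qed.
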